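(* On a uniform 3D Cartesian mesh with cell sizes $\Delta x_1,\Delta x_2,\Delta x_3$, let $\bar u_{\boldsymbol i}^n$ be cell averages (and let point values be given as in the context), and put $\mu_\ell=\Delta t^n/\Delta x_\ell$, $\nu_\ell=\Delta t^n/\Delta x_\ell^2$. Suppose that the low-order intermediate states $u^{\mathrm L,\pm}_{\ell,\boldsymbol i}$ (defined in the context) satisfy $u_{\ell,\boldsymbol i}^{\mathrm L,\pm}\in[u_{\min},u_{\max}]$ for $\ell=1,2,3$ and all $\boldsymbol i$, and that the CFL condition $$\Delta t^n\le\frac{C_{\mathrm{CFL}}}{\displaystyle\max_{\boldsymbol i,\ \ell=1,2,3}\Bigl(\frac{\alpha^n_{\ell,\boldsymbol i+\frac12\boldsymbol e_\ell}}{\Delta x_\ell}+\frac{\kappa_{\max}}{\Delta x_\ell^2}\Bigr)},\qquad C_{\mathrm{CFL}}\le\tfrac16,$$ holds. Consider the limited scheme $$\bar u_{\boldsymbol i}^{\mathrm{Lim}}=\bar u_{\boldsymbol i}^n-\sum_{\ell=1}^3\mu_\ell\bigl(\hat f^{\mathrm{Lim}}_{\ell,\boldsymbol i+\frac12\boldsymbol e_\ell}-\hat f^{\mathrm{Lim}}_{\ell,\boldsymbol i-\frac12\boldsymbol e_\ell}\bigr)+\sum_{\ell=1}^3\nu_\ell\bigl(\hat a^{\mathrm{Lim}}_{\ell,\boldsymbol i+\boldsymbol e_\ell}-2\hat a^{\mathrm{Lim}}_{\ell,\boldsymbol i}+\hat a^{\mathrm{Lim}}_{\ell,\boldsymbol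 i-\boldsymbol e_\ell}\bigr),$$ $$\hat f^{\mathrm{Lim}}_{\ell,\boldsymbol i+\frac12\boldsymbol e_\ell}=\hat f^{\mathrm L}_{\ell,\boldsymbol i+\frac12\boldsymbol e_\ell}+\theta^{\mathrm c}_{\ell,\boldsymbol i+\frac12\boldsymbol e_\ell}\Delta\hat f_{\ell,\boldsymbol i+\frac12\boldsymbol e_\ell},\qquad \hat a^{\mathrm{Lim}}_{\ell,\boldsymbol i}=\hat a^{\mathrm L}_{\ell,\boldsymbol i}+\theta^{\mathrm d}_{\ell,\boldsymbol i}\Delta\hat a_{\ell,\boldsymbol i},$$ with limiting parameters $$\theta^{\mathrm c}_{\ell,\boldsymbol i+\frac12\boldsymbol e_\ell}=\min\bigl\{\Theta(u^{\mathrm L,+}_{\ell,\boldsymbol i},u^{\mathrm L,+}_{\ell,\boldsymbol i}-18\mu_\ell\Delta\hat f_{\ell,\boldsymbol i+\frac12\boldsymbol e_\ell}),\ \Theta(u^{\mathrm L,-}_{\ell,\boldsymbol i+\boldsymbol e_\ell},u^{\mathrm L,-}_{\ell,\boldsymbol i+\boldsymbol e_\ell}+18\mu_\ell\Delta\hat f_{\ell,\boldsymbol i+\frac12\boldsymbol e_\ell})\bigr\},$$ $$\begin{aligned}\theta^{\mathrm d}_{\ell,\boldsymbol i}=\min\bigl\{&\Theta(u^{\mathrm L,+}_{\ell,\boldsymbol i-\boldsymbol e_\ell},u^{\mathrm L,+}_{\ell,\boldsymbol i-\boldsymbol e_\ell}+18\nu_\ell\Delta\hat a_{\ell,\boldsymbol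 i}),\ \Theta(u^{\mathrm L,+}_{\ell,\boldsymbol i},u^{\mathrm L,+}_{\ell,\boldsymbol i}-18\nu_\ell\Delta\hat a_{\ell,\boldsymbol i}),\\&\Theta(u^{\mathrm L,-}_{\ell,\boldsymbol i},u^{\mathrm L,-}_{\ell,\boldsymbol i}-18\nu_\ell\Delta\hat a_{\ell,\boldsymbol i}),\ \Theta(u^{\mathrm L,-}_{\ell,\boldsymbol i+\boldsymbol e_\ell},u^{\mathrm L,-}_{\ell,\boldsymbol i+\boldsymbol e_\ell}+18\nu_\ell\Delta\hat a_{\ell,\boldsymbol i})\bigr\}.\end{aligned}$$ Then the scheme is maximum-principle-preserving for the cell averages, i.e. $\bar u_{\boldsymbol i}^{\mathrm{Lim}}\in[u_{\min},u_{\max}]$ for all $\boldsymbol i$. Moreover, the convection discretization remains locally conservative, and the diffusion discretization remains doubly conservative in each direction.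
   Context: The equation is $u_t+\sum_{\ell=1}^3\partial_{x_\ell}f_\ell(u)=\Delta a(u)$ in three dimensions with $a(u)=\int^u\kappa(s)\,\mathrm ds$, $\kappa\ge0$. Here $\boldsymbol i=(i,j,k)$ and $\boldsymbol e_1,\boldsymbol e_2,\boldsymbol e_3$ are the standard unit multi-indices; indices are understood periodically. The degrees of freedom are the cell averages $\bar u_{\boldsymbol i}$ and point values $u_{\boldsymbol\zeta}$ at face centers, edge centers and corners of the cells (i.e. at indices $\boldsymbol i+\boldsymbol s$ with $\boldsymbol s\in\{-\frac12,0,\frac12\}^3\setminus\{0\}$, shared by neighboring cells). The cell-center value $u_{\boldsymbol i}$ is defined by inverting the tensor-product Simpson rule for the cell average, $\bar u_{\boldsymbol i}=\sum_{\boldsymbol s\in\{-\frac12,0,\frac12\}^3}w_{s_1}w_{s_2}w_{s_3}u_{\boldsymbol i+\boldsymbol s}$ with $w_{\pm\frac12}=\frac16$, $w_0=\frac46$. Low-order quantities: $\hat f^{\mathrm L}_{\ell,\boldsymbol i+\frac12\boldsymbol e_\ell}=\frac12(f_\ell(\bar u^n_{\boldsymbol i})+f_\ell(\bar u^n_{\boldsymbol i+\boldsymbol e_\ell}))-\frac12\alpha^n_{\ell,\boldsymbol i+\frac12\boldsymbol e_\ell}(\bar u^n_{\boldsymbol i+\boldsymbol e_\ell}-\bar u^n_{\boldsymbol i})$, where $\alpha^n_{\ell,\boldsymbol i+\frac12\boldsymbol e_\ell}$ is the maximum of $|f_\ell'(u)|$ over $u$ between $\bar u^n_{\boldsymbol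 i}$ and $\bar u^n_{\boldsymbol i+\boldsymbol e_\ell}$; $\hat a^{\mathrm L}_{\ell,\boldsymbol i+\frac12\boldsymbol e_\ell}=\frac1{\Delta x_\ell}(a(\bar u^n_{\boldsymbol i+\boldsymbol e_\ell})-a(\bar u^n_{\boldsymbol i}))$; $\hat a^{\mathrm L}_{\ell,\boldsymbol i}=a(\bar u^n_{\boldsymbol i})$; $\kappa_{\max}=\max_{u\in[u_{\min},u_{\max}]}\kappa(u)$. Low-order intermediate states: $$u^{\mathrm L,+}_{\ell,\boldsymbol i}=\bar u^n_{\boldsymbol i}-6\mu_\ell(\hat f^{\mathrm L}_{\ell,\boldsymbol i+\frac12\boldsymbol e_\ell}-f_\ell(\bar u^n_{\boldsymbol i}))+6\mu_\ell\hat a^{\mathrm L}_{\ell,\boldsymbol i+\frac12\boldsymbol e_\ell},$$ $$u^{\mathrm L,-}_{\ell,\boldsymbol i}=\bar u^n_{\boldsymbol i}-6\mu_\ell(f_\ell(\bar u^n_{\boldsymbol i})-\hat f^{\mathrm L}_{\ell,\boldsymbol i-\frac12\boldsymbol e_\ell})-6\mu_\ell\hat a^{\mathrm L}_{\ell,\boldsymbol i-\frac12\boldsymbol e_\ell}.$$ High-order quantities (from the fourth-order active flux method): $\hat f^{\mathrm H}_{\ell,\boldsymbol i+\frac12\boldsymbol e_\ell}$ is the tensor-product Simpson average of $f_\ell(u^n)$ over the face centered at $\boldsymbol i+\frac12\boldsymbol e_\ell$ (weights $\frac{1}{36}$ at the four corners, $\frac{4}{36}$ at the four edge centers, $\frac{16}{36}$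 at the face center); $\hat a^{\mathrm H}_{\ell,\boldsymbol i}$ is the tensor-product Simpson average in the two directions transverse to $\boldsymbol e_\ell$ (over index offsets $\{-\frac12,0,\frac12\}^2$, same weights) of the quantity $\frac16\bigl(-a(u^n_{\boldsymbol\eta-\frac12\boldsymbol e_\ell})+8a(u^n_{\boldsymbol\eta})-a(u^n_{\boldsymbol\eta+\frac12\boldsymbol e_\ell})\bigr)$, $\boldsymbol\eta$ being $\boldsymbol i$ shifted by the transverse offset. Corrections: $\Delta\hat f_{\ell,\boldsymbol i+\frac12\boldsymbol e_\ell}=\hat f^{\mathrm H}_{\ell,\boldsymbol i+\frac12\boldsymbol e_\ell}-\hat f^{\mathrm L}_{\ell,\boldsymbol i+\frac12\boldsymbol e_\ell}$, $\Delta\hat a_{\ell,\boldsymbol i}=\hat a^{\mathrm H}_{\ell,\boldsymbol i}-\hat a^{\mathrm L}_{\ell,\boldsymbol i}$. For $z^{\mathrm L}\in[u_{\min},u_{\max}]$ and real $z^{\mathrm H}$, $$\Theta(z^{\mathrm L},z^{\mathrm H})=\begin{cases}\dfrac{z^{\mathrm L}-u_{\min}}{z^{\mathrm L}-z^{\mathrm H}},&z^{\mathrm H}<u_{\min},\\[1ex]\dfrac{z^{\mathrm L}-u_{\max}}{z^{\mathrm L}-z^{\mathrm H}},&z^{\mathrm H}>u_{\max},\\[1ex]1,&z^{\mathrm H}\in[u_{\min},u_{\max}].\end{cases}$$ Locally conservative: in each direction $\ell$ the convection contribution to the update is $-\mu_\ell$ times a difference of single-valued interface fluxes consistent with $f_\ell$.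 Doubly conservative in direction $\ell$: the diffusion contribution is $\nu_\ell$ times a second difference in direction $\boldsymbol e_\ell$ of single-valued numerical potentials. Consistency means that when all cell averages and point values equal a constant $u$, the numerical flux equals $f_\ell(u)$ and the numerical potential equals $a(u)$. *)

(* Defs.v *)
From HB Require Import structures.
From mathcomp Require Import all_boot all_order all_algebra.
From mathcomp Require Import all_classical all_reals all_analysis.
Set Implicit Arguments.
Unset Strict Implicit.
Unset Printing Implicit Defensive.
Import Order.TTheory GRing.Theory Num.Theory.
Import numFieldNormedType.Exports.
Local Open Scope classical_set_scope.
Local Open Scope ring_scope.

(* Multi-indices.  The periodic mesh is represented by its unfolding over Z^3.
   A cell index i : idx is the integer multi-index; degrees of freedom are
   located by *doubled* multi-indices z : idx standing for z / 2, so that the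
   location i + s, with s in {-1/2, 0, 1/2}^3, is i *+ 2 + 2 s. *)
Notation idx := ('rV[int]_3).

Definition e (l : 'I_3) : idx := delta_mx 0 l.

Definition is_center (z : idx) : bool := [forall k, (2 %| z ord0 k)%Z].

Definition center_cell (z : idx) : idx := \row_k (z ord0 k %/ 2)%Z.

(* s : {ffun 'I_3 -> 'I_3} encodes the offset ((s k - 1) / 2)_k in
   {-1/2, 0, 1/2}^3; offset s is that offset in doubled coordinates. *)
Notation stencil := {ffun 'I_3 -> 'I_3}.

Definition offset (s : stencil) : idx := \row_k ((s k)%:Z - 1).

Definition mid : 'I_3 := inord 1.

Definition zero_offset : stencil := [ffun=> mid].

(* avg : cell averages; pt : point values at faces, edges and corners.  The
   entries of pt at cell centers are never read. *)
Record grid_data (R : realType) := GridData { avg : idx -> R; pt : idx -> R }.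

Section Scheme.
Context {R : realType}.

Definition w (t : 'I_3) : R := if t == mid then 4 / 6 else 1 / 6.

Definition wcell (s : stencil) : R := \prod_(k < 3) w (s k).

(* Tensor-product Simpson average, in the two directions transverse to l, of a
   quantity g attached to doubled indices. *)
Definition transverse_simpson (l : 'I_3) (g : idx -> R) (z : idx) : R :=
  \sum_(s : stencil | s l == mid)
    (\prod_(k < 3 | k != l) w (s k)) * g (z + offset s).

Definition mesh_periodic (N : 'I_3 -> nat) (d : grid_data R) : Prop :=
  (forall i k, avg d (i + e k *+ N k) = avg d i) /\
  (forall z k, ~~ is_center z -> pt d (z + e k *+ (N k).*2) = pt d z).

Definition constant_data (u : R) (d : grid_data R) : Prop :=
  (forall i, avg d i = u) /\ (forall z, ~~ is_center z -> pt d z = u).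

(* The value at the center of cell i, obtained by solving for it in
   avg d i = \sum_s wcell s * (value at i + s / 2); see cell_simpson below. *)
Definition center_value (d : grid_data R) (i : idx) : R :=
  (avg d i - \sum_(s : stencil | s != zero_offset)
               wcell s * pt d (i *+ 2 + offset s)) / wcell zero_offset.

Definition value (d : grid_data R) (z : idx) : R :=
  if is_center z then center_value d (center_cell z) else pt d z.

Definition has_max (A : set R) : Prop := exists2 m, A m & ubound A m.

(* |f'(u)| for u between v and v'. *)
Definition speeds (f : R -> R) (v v' : R) : set R :=
  [set `|derive1 f u| | u in `[Num.min v v', Num.max v v'] ].

(* a is an indefinite integral of kappa. *)
Definition indefinite_integral (kappa a : R -> R) : Prop :=
  locally_integrable setT kappa /\
  forall u v, u <= v ->
    a v - a u = Rintegral (@lebesgue_measure R) `[u, v] kappa.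

(* Maxima are written as suprema; has_max says when they are attained. *)
Definition kappa_max (kappa : R -> R) (umin umax : R) : R :=
  sup [set kappa u | u in `[umin, umax] ].

Definition Theta (umin umax zL zH : R) : R :=
  if zH < umin then (zL - umin) / (zL - zH)
  else if umax < zH then (zL - umax) / (zL - zH)
  else 1.

Variables (f : 'I_3 -> R -> R) (a : R -> R).
Variables (dx : 'I_3 -> R) (dt umin umax : R).

Definition mu (l : 'I_3) : R := dt / dx l.
Definition nu (l : 'I_3) : R := dt / dx l ^+ 2.

(* Every quantity carried by the face i + e_l / 2 (alpha, fL, aL_face, fH, df,
   theta_c, fLim) is indexed by the direction l and the cell i; the one at
   i - e_l / 2 is thus indexed by l and i - e l. *)
Definition alpha (d : grid_data R) (l : 'I_3) (i : idx) : R :=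
  sup (speeds (f l) (avg d i) (avg d (i + e l))).

(* The maximum over the mesh: for periodic data there are finitely many
   distinct values. *)
Definition cfl_rate (kappa : R -> R) (d : grid_data R) : R :=
  sup [set alpha d l i / dx l + kappa_max kappa umin umax / dx l ^+ 2
        | i in [set: idx] & l in [set: 'I_3] ].

Definition fL (d : grid_data R) (l : 'I_3) (i : idx) : R :=
  (f l (avg d i) + f l (avg d (i + e l))) / 2
  - alpha d l i / 2 * (avg d (i + e l) - avg d i).

Definition aL_face (d : grid_data R) (l : 'I_3) (i : idx) : R :=
  (a (avg d (i + e l)) - a (avg d i)) / dx l.

Definition aL (d : grid_data R) (l : 'I_3) (i : idx) : R := a (avg d i).

Definition uLp (d : grid_data R) (l : 'I_3) (i : idx) : R :=
  avg d i - 6 * mu l * (fL d l i - f l (avg d i)) + 6 * mu l * aL_face d l i.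

Definition uLm (d : grid_data R) (l : 'I_3) (i : idx) : R :=
  avg d i - 6 * mu l * (f l (avg d i) - fL d l (i - e l))
  - 6 * mu l * aL_face d l (i - e l).

Definition fH (d : grid_data R) (l : 'I_3) (i : idx) : R :=
  transverse_simpson l (fun z => f l (value d z)) (i *+ 2 + e l).

Definition aH (d : grid_data R) (l : 'I_3) (i : idx) : R :=
  transverse_simpson l
    (fun z => (- a (value d (z - e l)) + 8 * a (value d z)
               - a (value d (z + e l))) / 6)
    (i *+ 2).

Definition df (d : grid_data R) (l : 'I_3) (i : idx) : R := fH d l i - fL d l i.
Definition da (d : grid_data R) (l : 'I_3) (i : idx) : R := aH d l i - aL d l i.

Definition theta_c (d : grid_data R) (l : 'I_3) (i : idx) : R :=
  Num.min
    (Theta umin umax (uLp d l i) (uLp d l i - 18 * mu l * df d l i))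
    (Theta umin umax (uLm d l (i + e l))
       (uLm d l (i + e l) + 18 * mu l * df d l i)).

Definition theta_d (d : grid_data R) (l : 'I_3) (i : idx) : R :=
  Num.min
    (Num.min
       (Theta umin umax (uLp d l (i - e l))
          (uLp d l (i - e l) + 18 * nu l * da d l i))
       (Theta umin umax (uLp d l i) (uLp d l i - 18 * nu l * da d l i)))
    (Num.min
       (Theta umin umax (uLm d l i) (uLm d l i - 18 * nu l * da d l i))
       (Theta umin umax (uLm d l (i + e l))
          (uLm d l (i + e l) + 18 * nu l * da d l i))).

Definition fLim (d : grid_data R) (l : 'I_3) (i : idx) : R :=
  fL d l i + theta_c d l i * df d l i.

Definition aLim (d : grid_data R) (l : 'I_3) (i : idx) : R :=
  aL d l i + theta_d d l i * da d l i.

Definition convLim (d : grid_data R) (l : 'I_3) (i : idx) : R :=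
  - (mu l * (fLim d l i - fLim d l (i - e l))).

Definition diffLim (d : grid_data R) (l : 'I_3) (i : idx) : R :=
  nu l * (aLim d l (i + e l) - 2 * aLim d l i + aLim d l (i - e l)).

Definition uLim (d : grid_data R) (i : idx) : R :=
  avg d i + \sum_(l < 3) convLim d l i + \sum_(l < 3) diffLim d l i.

End Scheme.

Section Conservation.
Context {R : realType}.

(* One value per interface (or cell) of the periodic mesh. *)
Definition single_valued (N : 'I_3 -> nat)
    (F : grid_data R -> 'I_3 -> idx -> R) : Prop :=
  forall d, mesh_periodic N d -> forall l i k, F d l (i + e k *+ N k) = F d l i.

Definition consistent (g : 'I_3 -> R -> R)
    (F : grid_data R -> 'I_3 -> idx -> R) : Prop :=
  forall d u, constant_data u d -> forall l i, F d l i = g l u.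

(* conv d l i : contribution of direction l to the update of cell i;
   F d l i : numerical flux through the face i + e_l / 2. *)
Definition locally_conservative (N : 'I_3 -> nat) (mu : 'I_3 -> R)
    (f : 'I_3 -> R -> R) (conv F : grid_data R -> 'I_3 -> idx -> R) : Prop :=
  [/\ single_valued N F,
      consistent f F &
      forall d, mesh_periodic N d -> forall l i,
        conv d l i = - mu l * (F d l i - F d l (i - e l))].

(* A d l i : numerical potential of direction l in cell i. *)
Definition doubly_conservative (N : 'I_3 -> nat) (nu : 'I_3 -> R)
    (a : R -> R) (diff A : grid_data R -> 'I_3 -> idx -> R) : Prop :=
  [/\ single_valued N A,
      consistent (fun=> a) A &
      forall d, mesh_periodic N d -> forall l i,
        diff d l i = nu l * (A d l (i + e l) - 2 * A d l i + A d l (i - e l))].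

End Conservation.

Section CellSimpson.
Context {R : realType}.

Lemma mid_val : (mid : nat) = 1%N.
Proof. by rewrite /mid inordK. Qed.

Lemma offset0 : offset zero_offset = 0.
Proof. by apply/rowP => k; rewrite !mxE ffunE mid_val. Qed.

Lemma is_center_double i : is_center (i *+ 2).
Proof. by apply/forallP => k; rewrite !mxE -mulr2n -(mulr_natr (i ord0 k)) dvdz_mull. Qed.

Lemma center_cellK i : center_cell (i *+ 2) = i.
Proof. by apply/rowP => k; rewrite !mxE -mulr2n -(mulr_natr (i ord0 k)) mulzK. Qed.

Lemma is_center_offset i s : is_center (i *+ 2 + offset s) = (s == zero_offset).
Proof.
apply/idP/eqP => [/forallP H|->]; last by rewrite offset0 addr0 is_center_double.
apply/ffunP => k; rewrite ffunE; apply/val_inj; rewrite /= mid_val.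
have := H k; rewrite !mxE -mulr2n -(mulr_natr (i ord0 k)).
rewrite rpredDl ?dvdz_mull //.
by case: (s k) => -[|[|[|]]].
Qed.

Lemma cell_simpson (d : grid_data R) i :
  avg d i = \sum_(s : stencil) wcell s * value d (i *+ 2 + offset s).
Proof.
have w0 : wcell zero_offset != 0 :> R.
  apply/prodf_neq0 => k _; rewrite /w ffunE eqxx.
  by rewrite mulf_neq0 ?invr_eq0 ?pnatr_eq0.
rewrite (bigD1 zero_offset) //= {1}/value is_center_offset eqxx offset0 addr0.
rewrite center_cellK /center_value mulrC divfK //.
rewrite [X in _ + X](eq_bigr (fun s : stencil => wcell s * pt d (i *+ 2 + offset s))).
  by rewrite subrK.
by move=> s /negbTE sn; rewrite /value is_center_offset sn.
Qed.

End CellSimpson.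

(* Main.v *)
(** The limited update of a cell is the arithmetic mean of eighteen states, six
    per direction. Each of them is a low-order state [uLp] or [uLm] plus [theta]
    times one correction, and hence lies in [[umin, umax]] by the choice of
    [Theta]. *)
Require Import Defs.
From HB Require Import structures.
From mathcomp Require Import all_boot all_order all_algebra.
From mathcomp Require Import all_classical all_reals all_analysis.
From mathcomp Require Import ring lra.
Import Order.TTheory GRing.Theory Num.Theory.
Import numFieldNormedType.Exports.
Local Open Scope classical_set_scope.
Local Open Scope ring_scope.

(** * The limiting function [Theta] *)

Section Limiter.
Context {R : realType}.
Implicit Types umin umax zL zH t : R.

Lemma Theta_ge0 umin umax zL zH :
  umin <= zL <= umax -> 0 <= Theta umin umax zL zH.
Proof.
move=> /andP[mz zM]; rewrite /Theta; case: ltP => [zHm|_].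
  by rewrite divr_ge0 ?subr_ge0// ltW// (lt_le_trans zHm).
case: ltP => [MzH|//].
(* Negating numerator and denominator gives [(umax - zL) / (zH - zL)]. *)
by rewrite -mulrNN -invrN !opprB divr_ge0 ?subr_ge0// ltW// (le_lt_trans zM).
Qed.

(** [Theta] is the fraction of the segment from [zL] to [zH] at which it leaves the interval, or 1
    if it never does, so any shorter step stays inside. Smaller [t] must be allowed because each
    limiting parameter is a minimum of several values of [Theta]. *)
Lemma Theta_bounds umin umax zL zH t :
  umin <= zL <= umax -> 0 <= t <= Theta umin umax zL zH ->
  umin <= zL + t * (zH - zL) <= umax.
Proof.
move=> /andP[mz zM]; rewrite /Theta; case: ltP => [zHm|mzH].
  have p : 0 < zL - zH by rewrite subr_gt0 (lt_le_trans zHm).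
  by rewrite ler_pdivlMr// => /andP[t0 tT]; apply/andP; split; nra.
case: ltP => [MzH|zHM] /andP[t0]; last by move=> t1; apply/andP; split; nra.
have p : 0 < zH - zL by rewrite subr_gt0 (le_lt_trans zM).
rewrite -mulrNN -invrN !opprB ler_pdivlMr// => tT.
by apply/andP; split; nra.
Qed.

End Limiter.

(** * Simpson weights and exactness on constants *)

Section SimpsonWeights.
Context {R : realType}.

Lemma sum_w : \sum_(t < 3) w t = 1 :> R.
Proof. by rewrite !big_ord_recr big_ord0 /= /w -!val_eqE /= mid_val /=; field. Qed.

Lemma sum_wcell : \sum_(s : stencil) wcell s = 1 :> R.
Proof.
rewrite -(bigA_distr_bigA (fun=> w)) /=.
by rewrite big1// => k _; rewrite sum_w.
Qed.

Lemma sum_transverse_weights (l : 'I_3) :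
  \sum_(s : stencil | s l == mid) \prod_(k < 3 | k != l) w (s k) = 1 :> R.
Proof.
(* The condition [s l == mid] is encoded as a weight: in direction [l] the factor is the indicator
   of [mid]. The sum then factors into one-dimensional sums, each equal to 1. *)
pose F k t : R := if k == l then (t == mid)%:R else w t.
transitivity (\prod_k \sum_t F k t); last first.
  apply: big1 => k _; rewrite /F; case: eqP => _; last exact: sum_w.
  by rewrite (bigD1 mid)//= eqxx big1 ?addr0// => t /negbTE ->.
rewrite bigA_distr_bigA /= big_mkcond /=; apply: eq_bigr => s _.
rewrite [RHS](bigD1 l)//= {1}/F eqxx; case: eqP => _; last by rewrite mul0r.
by rewrite mul1r; apply: eq_bigr => k /negbTE kl; rewrite /F kl.
Qed.

Lemma transverse_simpson_const (l : 'I_3) (g : idx -> R) (c : R) (z : idx) :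
  (forall y, g y = c) -> transverse_simpson l g z = c.
Proof.
move=> gc; rewrite /transverse_simpson.
under eq_bigr do rewrite gc.
by rewrite -mulr_suml sum_transverse_weights mul1r.
Qed.

Lemma value_const (u : R) (d : grid_data R) (z : idx) :
  constant_data u d -> value d z = u.
Proof.
move=> [avg_u pt_u]; rewrite /value; case: ifPn => [_|]; last exact: pt_u.
rewrite /center_value avg_u.
have w0 : wcell zero_offset != 0 :> R.
  apply/prodf_neq0 => k _; rewrite /w ffunE eqxx.
  by rewrite mulf_neq0 ?invr_eq0 ?pnatr_eq0.
under eq_bigr => s s0 do rewrite pt_u ?is_center_offset//.
(* The off-center weights sum to [1 - wcell zero_offset], so the numerator is
   [u * wcell zero_offset]. *)
have := sum_wcell; rewrite (bigD1 zero_offset)//= -mulr_suml.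
move=> /(canRL (addKr _)) ->.
by field.
Qed.

End SimpsonWeights.

(** * Single-valuedness on the periodic mesh *)

Section Periodicity.
Context {R : realType} (N : 'I_3 -> nat) (d : grid_data R).
Hypothesis d_periodic : mesh_periodic N d.

Lemma is_centerD2 (z i : idx) : is_center (z + i *+ 2) = is_center z.
Proof.
apply: eq_forallb => k.
by rewrite !mxE -mulr2n -(mulr_natr (i ord0 k)) rpredDr ?dvdz_mull.
Qed.

Lemma center_cellD2 (z i : idx) : center_cell (z + i *+ 2) = center_cell z + i.
Proof.
apply/rowP => k; rewrite !mxE -mulr2n -(mulr_natr (i ord0 k)).
by rewrite divzDr ?dvdz_mull// mulzK.
Qed.

Lemma center_value_periodic (i : idx) k :
  center_value d (i + e k *+ N k) = center_value d i.
Proof.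
have [avgP ptP] := d_periodic.
rewrite /center_value avgP; congr ((_ - _) / _); apply: eq_bigr => s s0.
(* A shift by [N k] cells is one by [(N k).*2] doubled indices; [s != zero_offset] keeps the point
   off the cell centers, where [pt] is not assumed periodic. *)
by rewrite mulrnDl -mulrnA muln2 addrAC ptP// is_center_offset.
Qed.

Lemma value_periodic (z : idx) k :
  value d (z + e k *+ (N k).*2) = value d z.
Proof.
have [_ ptP] := d_periodic.
rewrite /value; case: (boolP (is_center z)) => zc; last first.
  by rewrite -muln2 mulrnA is_centerD2 (negbTE zc) -mulrnA muln2 ptP.
by rewrite -muln2 mulrnA is_centerD2 zc center_cellD2 center_value_periodic.
Qed.

Lemma transverse_simpson_periodic (l : 'I_3) (g : idx -> R) (z : idx) k :
  (forall y, g (y + e k *+ (N k).*2) = g y) ->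
  transverse_simpson l g (z + e k *+ (N k).*2) = transverse_simpson l g z.
Proof. by move=> gP; apply: eq_bigr => s _; rewrite addrAC gP. Qed.

Variables (f : 'I_3 -> R -> R) (a : R -> R) (dx : 'I_3 -> R).
Variables (dt umin umax : R) (l k : 'I_3).
Implicit Type i : idx.

Lemma fL_periodic i : fL f d l (i + e k *+ N k) = fL f d l i.
Proof.
have [avgP _] := d_periodic.
by rewrite /fL /alpha !(addrAC i (e k *+ _)) !avgP.
Qed.

Lemma aL_face_periodic i :
  aL_face a dx d l (i + e k *+ N k) = aL_face a dx d l i.
Proof.
have [avgP _] := d_periodic.
by rewrite /aL_face !(addrAC i (e k *+ _)) !avgP.
Qed.

Lemma uLp_periodic i :
  uLp f a dx dt d l (i + e k *+ N k) = uLp f a dx dt d l i.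
Proof. by rewrite /uLp fL_periodic aL_face_periodic d_periodic.1. Qed.

Lemma uLm_periodic i :
  uLm f a dx dt d l (i + e k *+ N k) = uLm f a dx dt d l i.
Proof.
by rewrite /uLm !(addrAC i (e k *+ _)) fL_periodic aL_face_periodic d_periodic.1.
Qed.

Lemma df_periodic i : df f d l (i + e k *+ N k) = df f d l i.
Proof.
rewrite /df fL_periodic /fH mulrnDl -mulrnA muln2 addrAC.
by rewrite transverse_simpson_periodic// => y; rewrite value_periodic.
Qed.

Lemma da_periodic i : da a d l (i + e k *+ N k) = da a d l i.
Proof.
rewrite /da /aL d_periodic.1 /aH mulrnDl -mulrnA muln2.
rewrite transverse_simpson_periodic// => y.
by rewrite !(addrAC y (e k *+ _)) !value_periodic.
Qed.

(** The limiting parameter belongs to the face and is built from periodic states on both of its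
    sides, so limiting keeps the flux single-valued. *)
Lemma fLim_periodic i :
  fLim f a dx dt umin umax d l (i + e k *+ N k)
  = fLim f a dx dt umin umax d l i.
Proof.
rewrite /fLim /theta_c !(addrAC i (e k *+ _)).
by rewrite fL_periodic df_periodic uLp_periodic uLm_periodic.
Qed.

Lemma aLim_periodic i :
  aLim f a dx dt umin umax d l (i + e k *+ N k)
  = aLim f a dx dt umin umax d l i.
Proof.
rewrite /aLim /theta_d /aL !(addrAC i (e k *+ _)).
by rewrite d_periodic.1 da_periodic !uLp_periodic !uLm_periodic.
Qed.

End Periodicity.

(** * Consistency of the limited fluxes and potentials *)

Section Consistency.
Context {R : realType}.
Variables (f : 'I_3 -> R -> R) (a : R -> R) (dx : 'I_3 -> R).
Variables (dt umin umax : R).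

(** On constant data the high- and low-order fluxes coincide, so the correction vanishes whatever
    the limiting parameter is. *)
Lemma fLim_consistent : consistent f (fLim f a dx dt umin umax).
Proof.
move=> d u du l i; have [avg_u _] := du.
have fLu : fL f d l i = f l u by rewrite /fL !avg_u; field.
rewrite /fLim /df /fH fLu (@transverse_simpson_const _ _ _ (f l u)).
  by rewrite subrr mulr0 addr0.
by move=> y; rewrite (value_const _ _ _ du).
Qed.

Lemma aLim_consistent : consistent (fun=> a) (aLim f a dx dt umin umax).
Proof.
move=> d u du l i; have [avg_u _] := du.
rewrite /aLim /da /aL /aH avg_u (@transverse_simpson_const _ _ _ (a u)).
  by rewrite subrr mulr0 addr0.
(* The coefficients are normalized: [(-1 + 8 - 1) / 6 = 1]. *)
by move=> y; rewrite !(value_const _ _ _ du); field.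
Qed.

End Consistency.

(** * The eighteen states and the maximum principle *)

Section MaximumPrinciple.
Context {R : realType}.
Variables (f : 'I_3 -> R -> R) (a : R -> R) (dx : 'I_3 -> R).
Variables (dt umin umax : R) (d : grid_data R).
Hypothesis uLp_bounds : forall l i, umin <= uLp f a dx dt d l i <= umax.
Hypothesis uLm_bounds : forall l i, umin <= uLm f a dx dt d l i <= umax.
Implicit Types (l : 'I_3) (i : idx).

Local Notation uLp := (uLp f a dx dt d).
Local Notation uLm := (uLm f a dx dt d).
Local Notation theta_c := (theta_c f a dx dt umin umax d).
Local Notation theta_d := (theta_d f a dx dt umin umax d).
Local Notation df := (df f d).
Local Notation da := (da a d).
Local Notation mu := (mu dx dt).
Local Notation nu := (nu dx dt).

Lemma theta_c_ge0 l i : 0 <= theta_c l i.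
Proof. by rewrite le_min !Theta_ge0. Qed.

Lemma theta_d_ge0 l i : 0 <= theta_d l i.
Proof. by rewrite !le_min !Theta_ge0. Qed.

(** [Theta_bounds] with the target written as a correction [c] of [z], the form in which all the
    limited states arise. *)
Lemma limited_bounds (z c t : R) : umin <= z <= umax -> 0 <= t ->
  t <= Theta umin umax z (z + c) -> umin <= z + t * c <= umax.
Proof.
move=> zb t0 tT; rewrite -[in t * c](addKr z c) [- z + _]addrC.
by apply: Theta_bounds => //; rewrite t0.
Qed.

(** Here and in the next five lemmas, the bound comes from the one argument of the minimum that
    guards this state of cell [i] against this correction. *)
Lemma uLp_conv l i : umin <= uLp l i + theta_c l i * (- (18 * mu l * df l i)) <= umax.
Proof.
by apply: limited_bounds => //; [exact: theta_c_ge0|rewrite ge_min lexx].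
Qed.

Lemma uLm_conv l i :
  umin <= uLm l i + theta_c l (i - e l) * (18 * mu l * df l (i - e l)) <= umax.
Proof.
apply: limited_bounds => //; first exact: theta_c_ge0.
(* At the face [i - e l], the second argument of the minimum concerns the cell [i - e l + e l],
   which is [i]. *)
by rewrite /Defs.theta_c subrK ge_min lexx orbT.
Qed.

Lemma uLp_diff_next l i :
  umin <= uLp l i + theta_d l (i + e l) * (18 * nu l * da l (i + e l)) <= umax.
Proof.
apply: limited_bounds => //; first exact: theta_d_ge0.
by rewrite /Defs.theta_d addrK !ge_min lexx.
Qed.

Lemma uLp_diff l i : umin <= uLp l i + theta_d l i * (- (18 * nu l * da l i)) <= umax.
Proof.
by apply: limited_bounds => //; [exact: theta_d_ge0|rewrite !ge_min lexx !orbT].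
Qed.

Lemma uLm_diff l i : umin <= uLm l i + theta_d l i * (- (18 * nu l * da l i)) <= umax.
Proof.
by apply: limited_bounds => //; [exact: theta_d_ge0|rewrite !ge_min lexx !orbT].
Qed.

Lemma uLm_diff_prev l i :
  umin <= uLm l i + theta_d l (i - e l) * (18 * nu l * da l (i - e l)) <= umax.
Proof.
apply: limited_bounds => //; first exact: theta_d_ge0.
by rewrite /Defs.theta_d subrK !ge_min lexx !orbT.
Qed.

(* The left-hand side is three times the share of direction [l] in the update
   when [avg d i] is split into three thirds; the factor 18 of the limiter is
   3 directions times 6 states. *)
Lemma direction_split l i :
  avg d i + 3 * convLim f a dx dt umin umax d l i
          + 3 * diffLim f a dx dt umin umax d l i
  = ((uLp l i + theta_c l i * (- (18 * mu l * df l i)))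
     + (uLm l i + theta_c l (i - e l) * (18 * mu l * df l (i - e l)))
     + (uLp l i + theta_d l (i + e l) * (18 * nu l * da l (i + e l)))
     + (uLp l i + theta_d l i * (- (18 * nu l * da l i)))
     + (uLm l i + theta_d l i * (- (18 * nu l * da l i)))
     + (uLm l i + theta_d l (i - e l) * (18 * nu l * da l (i - e l)))) / 6.
Proof.
(* In the three copies of [uLp] and of [uLm], the terms [f l (avg d i)] cancel and the [aL_face]
   terms form a second difference. Writing [nu] as [mu / dx] and naming the inverse of [dx l] leaves
   an identity of polynomials. *)
rewrite /convLim /diffLim /fLim /aLim /Defs.uLp /Defs.uLm /aL_face /aL subrK.
have -> : Defs.nu dx dt l = Defs.mu dx dt l / dx l.
  by rewrite /Defs.nu /Defs.mu expr2 invfM mulrA.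
by move: (dx l)^-1 => r; field.
Qed.

Lemma direction_bounds l i :
  umin <= avg d i + 3 * convLim f a dx dt umin umax d l i
                  + 3 * diffLim f a dx dt umin umax d l i <= umax.
Proof.
rewrite direction_split.
have /andP[? ?] := uLp_conv l i; have /andP[? ?] := uLm_conv l i.
have /andP[? ?] := uLp_diff_next l i; have /andP[? ?] := uLp_diff l i.
have /andP[? ?] := uLm_diff l i; have /andP[? ?] := uLm_diff_prev l i.
by apply/andP; split; lra.
Qed.

Lemma uLim_bounds i : umin <= uLim f a dx dt umin umax d i <= umax.
Proof.
rewrite /uLim !big_ord_recr !big_ord0 /= !add0r.
set l0 := widen_ord _ _; set l1 := widen_ord _ _.
have /andP[? ?] := direction_bounds l0 i.
have /andP[? ?] := direction_bounds l1 i.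
have /andP[? ?] := direction_bounds ord_max i.
(* [uLim] is the mean of the three directional quantities just bounded. *)
by apply/andP; split; lra.
Qed.

End MaximumPrinciple.

Theorem proposition5p2 (R : realType)
    (f : 'I_3 -> R -> R) (kappa a : R -> R)
    (N : 'I_3 -> nat) (dx : 'I_3 -> R) (dt C_CFL umin umax : R)
    (d : grid_data R)
    (f_derivable : forall l (u : R), derivable (f l) u 1)
    (f_speed_max : forall l v v', has_max (speeds (f l) v v'))
    (kappa_ge0 : forall u, 0 <= kappa u)
    (kappa_has_max : has_max [set kappa u | u in `[umin, umax] ])
    (a_primitive : indefinite_integral kappa a)
    (N_gt0 : forall l, (0 < N l)%N)
    (dx_gt0 : forall l, 0 < dx l)
    (dt_gt0 : 0 < dt)
    (d_periodic : mesh_periodic N d)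
    (uLp_bounds : forall l i, umin <= uLp f a dx dt d l i <= umax)
    (uLm_bounds : forall l i, umin <= uLm f a dx dt d l i <= umax)
    (C_CFL_le : C_CFL <= 1 / 6)
    (CFL : let M := cfl_rate f dx umin umax kappa d in
           0 < M -> dt <= C_CFL / M) :
  [/\ forall i, umin <= uLim f a dx dt umin umax d i <= umax,
      locally_conservative N (mu dx dt) f
        (convLim f a dx dt umin umax) (fLim f a dx dt umin umax) &
      doubly_conservative N (nu dx dt) a
        (diffLim f a dx dt umin umax) (aLim f a dx dt umin umax)].
Proof.
split.
- by move=> i; apply: uLim_bounds.
- split; first by move=> d' dP l i k; apply: fLim_periodic.
  + exact: fLim_consistent.
  + by move=> d' _ l i; rewrite mulNr.
- split; first by move=> d' dP l i k; apply: aLim_periodic.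
  + exact: aLim_consistent.
  + by [].
Qed.
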